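(* Let $f:X\to X'$ and $g:Y\to Y'$ be the inverse limits of inverse ANR-sequences $\mathbf{f}=\{f_i,(p_{i,i+1},p'_{i,i+1}),\mathbb{N}\}$ and $\mathbf{g}=\{g_i,(q_{i,i+1},q'_{i,i+1}),\mathbb{N}\}$, where $f_i:X_i\to X'_i$ and $g_i:Y_i\to Y'_i$. Let $(\varphi,\varphi'):f\to g$ be the inverse limit of a level morphism $\{(\varphi_i,\varphi'_i)\}:\mathbf{f}\to\mathbf{g}$, so that $\varphi=\varprojlim\varphi_i$ and $\varphi'=\varprojlim\varphi'_i$. Then for every $n$ there is a commutative diagram with exact rows $$\begin{array}{ccccccccc} 0&\to&\varprojlim{}^{1}H_{n+1}(f_i)&\to&\bar{\mathbf{H}}_n(f)&\to&\varprojlim H_n(f_i)&\to&0\\ &&\downarrow&&\downarrow&&\downarrow&&\\ 0&\to&\varprojlim{}^{1}H_{n+1}(g_i)&\to&\bar{\mathbf{H}}_n(g)&\to&\varprojlim H_n(g_i)&\to&0 \end{array}$$ whose vertical maps are, from left to right, $\varprojlim^1$ of the homomorphisms $(\varphi_i,\varphi'_i)_*:H_{n+1}(f_i)\to H_{n+1}(g_i)$, the homomorphism $(\varphi,\varphi')_*$, and $\varprojlim$ of the homomorphisms $(\varphi_i,\varphi'_i)_*:H_n(f_i)\to H_n(g_i)$.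
   Context: A morphism $(\varphi,\varphi'):f\to g$ from $f:X\to X'$ to $g:Y\to Y'$ is a pair of continuous maps $\varphi:X\to Y$, $\varphi':X'\to Y'$ with $g\varphi=\varphi'f$. An inverse ANR-sequence $\mathbf{f}=\{f_i,(p_{i,i+1},p'_{i,i+1}),\mathbb{N}\}:\mathbf{X}\to\mathbf{X}'$ consists of continuous maps $f_i:X_i\to X'_i$ of compact metric ANRs and morphisms $(p_{i,i+1},p'_{i,i+1}):f_{i+1}\to f_i$; its inverse limit is $f=\varprojlim f_i:\varprojlim X_i\to\varprojlim X'_i$. A level morphism $\{(\varphi_i,\varphi'_i)\}:\mathbf{f}\to\mathbf{g}$ consists of morphisms $(\varphi_i,\varphi'_i):f_i\to g_i$ with $\varphi_ip_{i,i+1}=q_{i,i+1}\varphi_{i+1}$ and $\varphi'_ip'_{i,i+1}=q'_{i,i+1}\varphi'_{i+1}$. $S_*$ is the singular chain complex ($S_n=0$ for $n<0$), with $h^{\#}$ the chain map induced by $h$. For a chain map $h:L_*\to M_*$ the chain cone $C_*(h)$ has $C_n(h)=L_{n-1}\oplus M_n$ with differential $(l,m)\mapsto(\partial l,-\partial m+h(l))$. For the ANR-map $f_i$ the (spectral) homology group is $H_n(f_i)=H_n(C_*(f_i^{\#}))$. A morphism $(\alpha,\alpha')$ of ANR-maps induces homomorphisms $(\alpha,\alpha')_*$ of these groups via $(l,m)\mapsto(\alpha^{\#}l,\alpha'^{\#}m)$, and in this way $\{H_n(f_i)\}$ is an inverse sequence of abelian groups. For an inverse sequence $\{A_i,a_{i,i+1}\}$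 of abelian groups, $\varprojlim A_i$ and $\varprojlim^1A_i$ are the kernel and cokernel of $\prod_iA_i\to\prod_iA_i$, $\{x_i\}\mapsto\{a_{i,i+1}(x_{i+1})-x_i\}$. Strong homology. Put $K_n(\mathbf{f})=\prod_iC_n(f_i^{\#})$ with componentwise differential, and let $(\mathbf{p}_{\#},\mathbf{p}'_{\#}):K_*(\mathbf{f})\to K_*(\mathbf{f})$ be the chain map $\{(c_i,c'_i)\}\mapsto\{(p_{i,i+1}^{\#}c_{i+1}-c_i,\;p_{i,i+1}'^{\#}c'_{i+1}-c'_i)\}$ with chain cone $C_*(\mathbf{p}_{\#},\mathbf{p}'_{\#})$. The strong homology groups of a map of compact metric spaces are computed from any strong ANR-expansion of it; the inverse limit $f=\varprojlim f_i$ of an inverse ANR-sequence $\mathbf{f}$ has $\mathbf{f}$ as such an expansion, so $$\bar{\mathbf{H}}_n(f)=H_{n+1}(C_*(\mathbf{p}_{\#},\mathbf{p}'_{\#})).$$ The same applies to $g$ with $C_*(\mathbf{q}_{\#},\mathbf{q}'_{\#})$. The homomorphism $(\varphi,\varphi')_*:\bar{\mathbf{H}}_n(f)\to\bar{\mathbf{H}}_n(g)$ induced by $(\varphi,\varphi')=\varprojlim(\varphi_i,\varphi'_i)$ is the one induced on homology by the chain map $C_*(\mathbf{p}_{\#},\mathbf{p}'_{\#})\to C_*(\mathbf{q}_{\#},\mathbf{q}'_{\#})$ applying $\varphi_i^{\#}$ and $\varphi_i'^{\#}$ componentwise: $(\{(x_i,x'_i)\},\{(y_i,y'_i)\})\mapsto(\{(\varphi_i^{\#}x_i,\varphi_i'^{\#}x'_i)\},\{(\varphi_i^{\#}y_i,\varphi_i'^{\#}y'_i)\})$.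 *)

(* Defs.v *)
From HB Require Import structures.
From mathcomp Require Import all_boot all_order all_algebra.
From mathcomp Require Import freeg zify.
From mathcomp Require Import all_classical reals topology normedtype.

Set Implicit Arguments.
Unset Strict Implicit.
Unset Printing Implicit Defensive.

Import Order.TTheory GRing.Theory Num.Theory.
Import numFieldNormedType.Exports.

Local Open Scope classical_set_scope.
Local Open Scope quotient_scope.
Local Open Scope ring_scope.

Section Kernel.
Variables (U V : zmodType) (f : {additive U -> V}).

Definition in_kernel : {pred U} := fun x => f x == 0.

Lemma in_kernel_zmod_closed : zmod_closed in_kernel.
Proof.
split=> [|x y]; rewrite !unfold_in ?raddf0 // => /eqP fx /eqP fy.
by rewrite raddfB fx fy subrr.
Qed.

HB.instance Definition _ := GRing.isZmodClosed.Build U in_kernel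
  in_kernel_zmod_closed.

Record kernel := Kernel { kernel_val :> U; _ : kernel_val \in in_kernel }.

HB.instance Definition _ := [isSub for kernel_val].
HB.instance Definition _ := [Choice of kernel by <:].
HB.instance Definition _ := [SubChoice_isSubZmodule of kernel by <:].

Lemma kernelP (x : kernel) : f (val x) = 0.
Proof. by have := valP x; rewrite unfold_in => /eqP. Qed.

End Kernel.

Section KernelMap.
Variables (U V U' V' : zmodType).
Variables (f : {additive U -> V}) (f' : {additive U' -> V'}).
Variables (a : {additive U -> U'}) (b : {additive V -> V'}).
Hypothesis abf : forall x, f' (a x) = b (f x).

Lemma kernel_map_subproof (x : kernel f) : a (val x) \in in_kernel f'.
Proof. by rewrite unfold_in abf kernelP raddf0. Qed.

Definition kernel_map (x : kernel f) : kernel f' :=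
  Kernel (kernel_map_subproof x).

Lemma kernel_map_is_additive : zmod_morphism kernel_map.
Proof. by move=> x y; apply: val_inj; rewrite /= !raddfB. Qed.

HB.instance Definition _ := GRing.isZmodMorphism.Build (kernel f) (kernel f')
  kernel_map kernel_map_is_additive.

End KernelMap.

Section QuotientMap.
Variables (U V : zmodType) (I : zmodClosed U) (J : zmodClosed V).
Variables (f : {additive U -> V}).
Hypothesis fIJ : forall x, x \in I -> f x \in J.

Definition quotient_fun (x : {ideal_quot I}) : {ideal_quot J} :=
  \pi_{ideal_quot J} (f (repr x)).

Lemma quotient_funE x :
  quotient_fun (\pi_{ideal_quot I} x) = \pi_{ideal_quot J} (f x).
Proof.
apply/eqP; rewrite -Quotient.idealrBE -raddfB; apply: fIJ.
by rewrite Quotient.idealrBE reprK.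
Qed.

Lemma quotient_fun_is_additive : zmod_morphism quotient_fun.
Proof.
move=> x y; rewrite -[x]reprK -[y]reprK.
have piB W (K : zmodClosed W) (u v : W) :
  \pi_{ideal_quot K} (u - v) = \pi_{ideal_quot K} u - \pi_{ideal_quot K} v.
  by rewrite !piE.
by rewrite -piB !quotient_funE raddfB piB.
Qed.

Definition quotient_map : {additive {ideal_quot I} -> {ideal_quot J}} :=
  HB.pack quotient_fun (GRing.isZmodMorphism.Build _ _ quotient_fun
    quotient_fun_is_additive).

End QuotientMap.

Section Cokernel.
Variables (U V : zmodType) (f : {additive U -> V}).

Definition in_image : {pred V} := fun y => `[< exists x, f x = y >].

Lemma in_image_zmod_closed : zmod_closed in_image.
Proof.
split=> [|_ _ /asboolP[x <-] /asboolP[y <-]]; apply/asboolP.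
  by exists 0; rewrite raddf0.
by exists (x - y); rewrite raddfB.
Qed.

HB.instance Definition _ := GRing.isZmodClosed.Build V in_image
  in_image_zmod_closed.

Definition cokernel : zmodType := {ideal_quot in_image}.

End Cokernel.

Section CokernelMap.
Variables (U V U' V' : zmodType).
Variables (f : {additive U -> V}) (f' : {additive U' -> V'}).
Variables (a : {additive U -> U'}) (b : {additive V -> V'}).
Hypothesis abf : forall x, f' (a x) = b (f x).

Lemma cokernel_map_subproof y : y \in in_image f -> b y \in in_image f'.
Proof. by move=> /asboolP[x <-]; apply/asboolP; exists (a x). Qed.

Definition cokernel_map : {additive cokernel f -> cokernel f'} :=
  quotient_map cokernel_map_subproof.

End CokernelMap.

Section Product.

Definition product (A : nat -> zmodType) : Type := forall i, A i.

Variables (A B : nat -> zmodType).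

HB.instance Definition _ := gen_eqMixin (product A).
HB.instance Definition _ := gen_choiceMixin (product A).

Let add (x y : product A) : product A := fun i => x i + y i.
Let opp (x : product A) : product A := fun i => - x i.
Let zero : product A := fun=> 0.

Let addA : associative add.
Proof.
by move=> x y z; apply: functional_extensionality_dep => i; apply: addrA.
Qed.
Let addC : commutative add.
Proof.
by move=> x y; apply: functional_extensionality_dep => i; apply: addrC.
Qed.
Let add0 : left_id zero add.
Proof.
by move=> x; apply: functional_extensionality_dep => i; apply: add0r.
Qed.
Let addN : left_inverse zero opp add.
Proof.
by move=> x; apply: functional_extensionality_dep => i; apply: addNr.
Qed.

HB.instance Definition _ :=
  GRing.isZmodule.Build (product A) addA addC add0 addN.

End Product.

Section ProductMap.
Variables (A B : nat -> zmodType) (f : forall i, {additive A i -> B i}).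

Definition product_map (x : product A) : product B := fun i => f i (x i).

Lemma product_map_is_additive : zmod_morphism product_map.
Proof.
by move=> x y; apply: functional_extensionality_dep => i; apply: raddfB.
Qed.

HB.instance Definition _ := GRing.isZmodMorphism.Build (product A) (product B)
  product_map product_map_is_additive.

End ProductMap.

Section InverseSequence.
Variables (A : nat -> zmodType) (a : forall i, {additive A i.+1 -> A i}).

Definition shift_diff (x : product A) : product A :=
  fun i => a i (x i.+1) - x i.

Lemma shift_diff_is_additive : zmod_morphism shift_diff.
Proof.
move=> x y; apply: functional_extensionality_dep => i.
by rewrite /shift_diff raddfB /= opprD addrACA -opprD.
Qed.

HB.instance Definition _ := GRing.isZmodMorphism.Build (product A) (product A)
  shift_diff shift_diff_is_additive.

Definition lim0 : zmodType := kernel shift_diff.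
Definition lim1 : zmodType := cokernel shift_diff.

End InverseSequence.

Section InverseSequenceMap.
Variables (A B : nat -> zmodType).
Variables (a : forall i, {additive A i.+1 -> A i}).
Variables (b : forall i, {additive B i.+1 -> B i}).
Variables (f : forall i, {additive A i -> B i}).
Hypothesis fab : forall i x, b i (f i.+1 x) = f i (a i x).

Lemma shift_diff_natural x :
  shift_diff b (product_map f x) = product_map f (shift_diff a x).
Proof.
apply: functional_extensionality_dep => i.
by rewrite /shift_diff /product_map fab raddfB.
Qed.

Definition lim0_map : {additive lim0 a -> lim0 b} :=
  kernel_map shift_diff_natural.
Definition lim1_map : {additive lim1 a -> lim1 b} :=
  cokernel_map shift_diff_natural.

End InverseSequenceMap.

Record chain_complex := ChainComplex {
  chain :> int -> zmodType;
  diff : forall n, {additive chain n -> chain (n - 1)};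
  diffK : forall n c, diff (n - 1) (diff n c) = 0
}.
Arguments diff C n : rename.

Record chain_map (L M : chain_complex) := ChainMap {
  chain_fun :> forall n, {additive L n -> M n};
  chain_funE : forall n c,
    chain_fun (n - 1) (diff L n c) = diff M n (chain_fun n c)
}.

Lemma ecastB (C : int -> zmodType) m n (e : m = n) x y :
  ecast k (C k) e (x - y) = ecast k (C k) e x - ecast k (C k) e y.
Proof. by case: _ / e. Qed.

Section Homology.
Variables (C : chain_complex) (n : int).

Definition cycles : zmodType := kernel (diff C n).

(* [n + 1 - 1] is only propositionally equal to [n], hence the cast. *)
Definition boundaries : {pred cycles} := fun z => `[< exists c : C (n + 1),
  ecast m (C m) (addrK 1 n) (diff C (n + 1) c) = val z >].

Lemma boundaries_zmod_closed : zmod_closed boundaries.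
Proof.
split=> [|u v /asboolP[x xu] /asboolP[y yv]]; apply/asboolP.
  by exists 0; rewrite -(subrr 0) raddfB ecastB subrr.
by exists (x - y); rewrite raddfB ecastB xu yv raddfB.
Qed.

HB.instance Definition _ := GRing.isZmodClosed.Build cycles boundaries
  boundaries_zmod_closed.

Definition homology : zmodType := {ideal_quot boundaries}.

End Homology.

Section HomologyMap.
Variables (L M : chain_complex) (h : chain_map L M) (n : int).

Definition cycles_map : {additive cycles L n -> cycles M n} :=
  kernel_map (fun c => esym (chain_funE h c)).

Lemma chain_fun_ecast k m (e : k = m) (c : L k) :
  h m (ecast j (L j) e c) = ecast j (M j) e (h k c).
Proof. by case: _ / e. Qed.

Lemma homology_map_subproof z :
  z \in @boundaries L n -> cycles_map z \in @boundaries M n.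
Proof.
move=> /asboolP[c cz]; apply/asboolP; exists (h (n + 1) c).
by rewrite -chain_funE -chain_fun_ecast cz.
Qed.

Definition homology_map : {additive homology L n -> homology M n} :=
  quotient_map homology_map_subproof.

Lemma homology_mapE z :
  homology_map (\pi_{ideal_quot (@boundaries L n)} z) =
  \pi_{ideal_quot (@boundaries M n)} (cycles_map z).
Proof. exact: (quotient_funE homology_map_subproof). Qed.

End HomologyMap.

Lemma homology_map_comm (L M M' N : chain_complex)
    (h : chain_map L M) (k : chain_map M N)
    (h' : chain_map L M') (k' : chain_map M' N) n :
  (forall c, k n (h n c) = k' n (h' n c)) -> forall z,
  homology_map k n (homology_map h n z) =
  homology_map k' n (homology_map h' n z).
Proof.
move=> hk z; rewrite -[z]reprK !homology_mapE; congr (\pi_ _ _).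
exact/val_inj/hk.
Qed.

Section Cone.
Variables (L M : chain_complex) (h : chain_map L M).

Definition cone_chain (n : int) : zmodType := (L (n - 1) * M n)%type.

Definition cone_diff n (c : cone_chain n) : cone_chain (n - 1) :=
  (diff L (n - 1) c.1, - diff M n c.2 + h (n - 1) c.1).

Lemma cone_diff_is_additive n : zmod_morphism (@cone_diff n).
Proof.
move=> x y; congr pair; first exact: raddfB.
by rewrite /= !raddfB /= opprK [in RHS]opprD opprK [RHS]addrACA.
Qed.

HB.instance Definition _ n := GRing.isZmodMorphism.Build
  (cone_chain n) (cone_chain (n - 1)) (@cone_diff n) (@cone_diff_is_additive n).

Lemma cone_diffK n c : cone_diff (@cone_diff n c) = 0.
Proof.
congr pair; first exact: diffK.
by rewrite /= raddfD raddfN /= diffK oppr0 add0r chain_funE addNr.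
Qed.

Definition cone : chain_complex :=
  @ChainComplex cone_chain (fun n => @cone_diff n) cone_diffK.

End Cone.

Section ConeMap.
Variables (L M L' M' : chain_complex).
Variables (h : chain_map L M) (h' : chain_map L' M').
Variables (a : chain_map L L') (b : chain_map M M').
Hypothesis abh : forall n c, h' n (a n c) = b n (h n c).

Definition cone_fun n (c : cone h n) : cone h' n := (a (n - 1) c.1, b n c.2).

Lemma cone_fun_is_additive n : zmod_morphism (@cone_fun n).
Proof. by move=> x y; congr pair; apply: raddfB. Qed.

HB.instance Definition _ n := GRing.isZmodMorphism.Build
  (cone h n) (cone h' n) (@cone_fun n) (@cone_fun_is_additive n).

Lemma cone_funE n (c : cone h n) :
  @cone_fun (n - 1) (diff (cone h) n c) = diff (cone h') n (cone_fun c).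
Proof.
by congr pair; rewrite /= ?raddfD ?raddfN /= !chain_funE ?abh.
Qed.

Definition cone_map : chain_map (cone h) (cone h') :=
  @ChainMap (cone h) (cone h') (fun n => @cone_fun n) cone_funE.

End ConeMap.

Section ProductComplex.
Variable C : nat -> chain_complex.

Definition product_chain (n : int) : zmodType := product (fun i => C i n).

Definition product_diff n :
    {additive product_chain n -> product_chain (n - 1)} :=
  product_map (fun i => diff (C i) n).

Lemma product_diffK n c : product_diff (n - 1) (product_diff n c) = 0.
Proof. by apply: functional_extensionality_dep => i; apply: diffK. Qed.

Definition product_complex : chain_complex := ChainComplex product_diffK.

Variable p : forall i, chain_map (C i.+1) (C i).

Definition shift_fun n : {additive product_complex n -> product_complex n} :=
  shift_diff (fun i => p i n).

Lemma shift_funE n c :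
  shift_fun (n - 1) (diff product_complex n c) =
  diff product_complex n (shift_fun n c).
Proof.
apply: functional_extensionality_dep => i.
by rewrite /= /product_map /shift_diff raddfB chain_funE.
Qed.

Definition shift_map : chain_map product_complex product_complex :=
  ChainMap shift_funE.

End ProductComplex.

Section ProductComplexMap.
Variables (C D : nat -> chain_complex) (f : forall i, chain_map (C i) (D i)).

Definition product_complex_fun n :
    {additive product_complex C n -> product_complex D n} :=
  product_map (fun i => f i n).

Lemma product_complex_funE n c :
  product_complex_fun (n - 1) (diff (product_complex C) n c) =
  diff (product_complex D) n (product_complex_fun n c).
Proof. by apply: functional_extensionality_dep => i; apply: chain_funE. Qed.

Definition product_complex_map :
    chain_map (product_complex C) (product_complex D) :=
  ChainMap product_complex_funE.

End ProductComplexMap.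

Lemma row_continuous (R : realType) (T : topologicalType) m
    (f : T -> 'rV[R]_m) :
  (forall j, continuous (fun x => f x 0 j)) -> continuous f.
Proof.
move=> fc x A [P Px PA].
apply: (@filterS _ _ _ [set y | forall i j, P i j (f y i j)]).
  by move=> y Py; apply: PA.
apply: filter_forall => i; apply: filter_forall => j.
by move: (Px i j); rewrite (ord1 i) => /fc.
Qed.

Definition simplex (R : realType) (k : nat) : set 'rV[R]_k.+1 :=
  [set x | (forall i, 0 <= x 0 i) /\ \sum_i x 0 i = 1].
Arguments simplex R k : clear implicits.

(* [push a] is the affine map of standard simplices given by [a] on vertices;
   in particular [push (fintype.lift i)] is the i-th face inclusion. *)
Section Push.
Variables (R : realType) (k m : nat) (a : 'I_k.+1 -> 'I_m.+1).

Definition push_row (x : 'rV[R]_k.+1) : 'rV[R]_m.+1 :=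
  \row_j \sum_(i | a i == j) x 0 i.

Lemma push_row_simplex (x : simplex R k) : push_row (val x) \in simplex R m.
Proof.
have /set_mem[x0 x1] := valP x; apply/mem_set; split=> [j|].
  by rewrite mxE sumr_ge0.
rewrite -x1 (partition_big a xpredT) //=.
by apply: eq_bigr => j _; rewrite mxE.
Qed.

Definition push (x : simplex R k) : simplex R m :=
  exist (fun y => y \in simplex R m) _ (push_row_simplex x).

Lemma push_row_continuous : continuous push_row.
Proof.
apply: row_continuous => j x; rewrite /push_row.
under eq_fun do rewrite mxE.
apply: cvg_big => [||i _]; first exact: add_continuous.
  exact: (nbhs_filter x).
exact: coord_continuous.
Qed.

Lemma push_continuous : continuous push.
Proof.
apply: continuous_comp_initial => x.
apply: (@continuous_comp _ _ _ (set_val : simplex R k -> _) push_row).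
  exact: initial_continuous.
exact: push_row_continuous.
Qed.

HB.instance Definition _ := isContinuous.Build (simplex R k) (simplex R m) push
  push_continuous.

End Push.

Lemma push_comp (R : realType) k l m (a : 'I_k.+1 -> 'I_l.+1)
    (b : 'I_l.+1 -> 'I_m.+1) (x : simplex R k) :
  push b (push a x) = push (b \o a) x.
Proof.
apply: val_inj; apply/rowP => j; rewrite !mxE.
rewrite [RHS](partition_big a (fun i => b i == j)) //=.
apply: eq_bigr => i /eqP bi; rewrite mxE; apply: eq_bigl => l0.
by case: eqVneq => [->|]; rewrite ?bi ?eqxx ?andbF.
Qed.

Lemma freeg_additive_eq (K : choiceType) (V : zmodType)
    (f g : {additive {freeg K / int} -> V}) :
  (forall x, f << x >> = g << x >>) -> f =1 g.
Proof.
move=> fg c; rewrite -[c]freeg_sumE !raddf_sum; apply: eq_bigr => x _.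
by rewrite -[coeff _ _]intz -freegU_mulz !raddfMz fg.
Qed.

HB.instance Definition _ (K : choiceType) (M : lmodType int) (f : K -> M) :=
  GRing.isZmodMorphism.Build {freeg K / int} M (fglift f)
    (lift_is_additive f).

Lemma fgliftU (K : choiceType) (M : lmodType int) (f : K -> M) x :
  fglift f << x >> = f x.
Proof. by rewrite liftU scale1r. Qed.

Lemma fgliftZ (K : choiceType) (M : lmodType int) (f : K -> M) z x :
  fglift f << z *g x >> = f x *~ z.
Proof. by rewrite liftU -{1}[z]intz scaler_int. Qed.

Section SingularSimplices.
Variables (R : realType) (X : topologicalType).

(* No simplices in negative degree, so that [singular_chain] vanishes there. *)
Definition singular_simplex (n : int) : choiceType :=
  match n with
  | Posz k => continuousType (simplex R k) X
  | Negz _ => void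
  end.

Definition singular_chain (n : int) : zmodType :=
  {freeg (singular_simplex n) / int}.

Definition face k (i : 'I_k.+2) (s : continuousType (simplex R k.+1) X) :
  continuousType (simplex R k) X := s \o push (fintype.lift i).

Lemma predSz (k : nat) : Posz k = Posz k.+1 - 1.
Proof. by rewrite intS addrAC subrr add0r. Qed.

Definition face_sum k (s : continuousType (simplex R k.+1) X) :
    singular_chain k :=
  \sum_(i < k.+2) << (-1) ^+ i *g (face i s : singular_simplex k) >>.

Definition simplex_boundary (n : int) :
    singular_simplex n -> singular_chain (n - 1) :=
  match n return singular_simplex n -> singular_chain (n - 1) with
  | Posz k.+1 => fun s =>
      ecast m (singular_chain m) (predSz k) (face_sum s)
  | _ => fun=> 0
  end.

Definition singular_diff (n : int) :
    singular_chain n -> singular_chain (n - 1) :=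
  fglift (@simplex_boundary n).

HB.instance Definition _ n := GRing.isZmodMorphism.Build
  (singular_chain n) (singular_chain (n - 1)) (@singular_diff n)
  (lift_is_additive (@simplex_boundary n)).

Lemma singular_diff_ecast (m n : int) (e : m = n) c :
  singular_diff (ecast k (singular_chain k) e c) =
  ecast k (singular_chain (k - 1)) e (singular_diff c).
Proof. by case: _ / e. Qed.

Lemma ecast0 (C : int -> zmodType) (m n : int) (e : m = n) :
  ecast k (C k) e 0 = 0.
Proof. by case: _ / e. Qed.

Definition face_swap k (p : 'I_k.+3 * 'I_k.+2) : 'I_k.+3 * 'I_k.+2 :=
  if (p.2 < p.1)%N then (inord p.2, inord p.1.-1)
  else (inord p.2.+1, inord p.1).

Lemma face_swapK k : involutive (@face_swap k).
Proof.
case=> i j; rewrite /face_swap /=; have [ji|ij] := ltnP j i => /=.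
  have i1 : (i.-1 < k.+2)%N by case: i {ji} (ji) => /=; lia.
  have j1 : (j < k.+3)%N by apply: ltn_trans ji _.
  rewrite !inordK // ifN; last by lia.
  by congr pair; apply: val_inj; rewrite /= inordK //; lia.
have i1 : (i < k.+2)%N by apply: leq_ltn_trans ij _.
have j1 : (j.+1 < k.+3)%N by rewrite ltnS.
rewrite !inordK // ifT //.
by congr pair; apply: val_inj; rewrite /= inordK // ltnW.
Qed.

Lemma face_swap_lt k (p : 'I_k.+3 * 'I_k.+2) :
  ((face_swap p).2 < (face_swap p).1)%N = ~~ (p.2 < p.1)%N.
Proof.
case: p => i j; rewrite /face_swap /=; have [ji|ij] := ltnP j i => /=.
  have i1 : (i.-1 < k.+2)%N by case: i {ji} (ji) => /=; lia.
  have j1 : (j < k.+3)%N by apply: ltn_trans ji _.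
  by rewrite !inordK //; lia.
have i1 : (i < k.+2)%N by apply: leq_ltn_trans ij _.
have j1 : (j.+1 < k.+3)%N by rewrite ltnS.
by rewrite !inordK //; lia.
Qed.

Lemma face_face k (p : 'I_k.+3 * 'I_k.+2)
    (s : continuousType (simplex R k.+2) X) :
  (p.2 < p.1)%N ->
  face (face_swap p).2 (face (face_swap p).1 s) = face p.2 (face p.1 s).
Proof.
case: p => i j /= ji; apply/continuousEP => x /=.
rewrite !push_comp; congr (s (push _ x)); apply: funext => l.
apply: val_inj; rewrite /face_swap ji /= /bump.
have i1 : (i.-1 < k.+2)%N by case: i {ji} (ji) => /=; lia.
have j1 : (j < k.+3)%N by apply: ltn_trans ji _.
rewrite !inordK //.
case: (i : nat) ji i1 => // i'; rewrite ltnS /= => ji _.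
case: (leqP i' l) => il; case: (leqP j l) => jl; lia.
Qed.

Lemma face_sumK k (s : singular_simplex k.+2) :
  fglift (@face_sum k) (face_sum s) = 0.
Proof.
pose T (p : 'I_k.+3 * 'I_k.+2) : singular_chain k :=
  << (-1) ^+ (p.1 + p.2) *g (face p.2 (face p.1 s) : singular_simplex k) >>.
transitivity (\sum_p T p).
  rewrite /face_sum raddf_sum /= -(pair_bigA _ (fun i j => T (i, j))) /=.
  apply: eq_bigr => i _; rewrite fgliftZ /face_sum mulrz_suml.
  by apply: eq_bigr => j _; rewrite freeg_mulz /T /= addnC exprD mulrzz.
rewrite (bigID (fun p : 'I_k.+3 * 'I_k.+2 => p.2 < p.1)%N) /=.
rewrite [X in _ + X](reindex_inj (inv_inj (@face_swapK k))) /=.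
rewrite [X in _ + X](eq_bigl
  (fun p : 'I_k.+3 * 'I_k.+2 => p.2 < p.1)%N); last first.
  by move=> p; rewrite face_swap_lt negbK.
rewrite -big_split big1 // => p ji /=.
rewrite /T (face_face _ ji) freegUD.
suff -> : (-1) ^+ ((face_swap p).1 + (face_swap p).2) =
          - (-1) ^+ (p.1 + p.2) :> int.
  by rewrite subrr freegU0.
case: p ji => i j /= ji; rewrite /face_swap ji /=.
have i1 : (i.-1 < k.+2)%N by case: i {ji} (ji) => /=; lia.
have j1 : (j < k.+3)%N by apply: ltn_trans ji _.
rewrite !inordK //; case: (i : nat) ji i1 => // i' _ _ /=.
by rewrite addSn exprS mulN1r opprK addnC.
Qed.

Lemma fglift_ecast k m (e : Posz k = m) (c : singular_chain k.+1) :
  fglift (fun s : singular_simplex k.+1 =>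
    ecast m (singular_chain m) e (face_sum s)) c =
  ecast m (singular_chain m) e (fglift (@face_sum k) c).
Proof. by case: _ / e. Qed.

Lemma singular_diffS k (c : singular_chain (Posz k.+1)) :
  singular_diff c =
  ecast m (singular_chain m) (predSz k) (fglift (@face_sum k) c).
Proof. exact: fglift_ecast. Qed.

Lemma singular_diffK n c : singular_diff (@singular_diff n c) = 0.
Proof.
case: n c => [[|[|k]]|k] c.
- rewrite -[RHS](raddf0 (@singular_diff (0 - 1))); congr singular_diff.
  by apply: (freeg_additive_eq (g := \0)) => x;
    rewrite /= /singular_diff fgliftU.
- rewrite singular_diffS singular_diff_ecast.
  set d := fglift _ c; suff -> : singular_diff d = 0 by rewrite ecast0.
  by apply: (freeg_additive_eq (g := \0)) => x;
    rewrite /= /singular_diff fgliftU.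
- rewrite singular_diffS singular_diff_ecast.
  rewrite singular_diffS.
  suff -> : fglift (@face_sum k) (fglift (@face_sum k.+1) c) = 0
    by rewrite !ecast0.
  apply: (freeg_additive_eq (f := fglift _ \o fglift _) (g := \0)) => x.
  by rewrite /= fgliftU face_sumK.
- by apply: (freeg_additive_eq (f := @singular_diff _ \o @singular_diff _)
    (g := \0)) => -[].
Qed.

Definition singular : chain_complex :=
  @ChainComplex singular_chain (fun n => @singular_diff n) singular_diffK.

End SingularSimplices.
Arguments singular R X : clear implicits.

Section SingularMap.
Variables (R : realType) (X Y : topologicalType) (h : continuousType X Y).

Definition simplex_map (n : int) :
    singular_simplex R X n -> singular_simplex R Y n :=
  match n return singular_simplex R X n -> singular_simplex R Y n with
  | Posz k => fun s : continuousType (simplex R k) X =>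
      (h \o s : continuousType (simplex R k) Y)
  | Negz _ => id
  end.

Definition singular_fun n (c : singular R X n) : singular R Y n :=
  fglift (fun s => << @simplex_map n s >>) c.

HB.instance Definition _ n := GRing.isZmodMorphism.Build
  (singular R X n) (singular R Y n) (@singular_fun n)
  (lift_is_additive (fun s => << @simplex_map n s >>)).

Lemma singular_fun_ecast (m n : int) (e : m = n) c :
  singular_fun (ecast k (singular R X k) e c) =
  ecast k (singular R Y k) e (singular_fun c).
Proof. by case: _ / e. Qed.

Lemma singular_funE n c :
  @singular_fun (n - 1) (diff (singular R X) n c) =
  diff (singular R Y) n (singular_fun c).
Proof.
move: c; apply: (freeg_additive_eq
  (f := @singular_fun _ \o @singular_diff R X n)
  (g := @singular_diff R Y n \o @singular_fun n)) => s /=.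
rewrite /singular_fun fgliftU /singular_diff !fgliftU.
case: n s => [[|k]|[]] //; first by move=> s; apply: raddf0.
move=> s.
apply: etrans (singular_fun_ecast (predSz k) (face_sum s)) _.
congr (ecast _ _ _ _); rewrite /singular_fun /face_sum raddf_sum.
apply: eq_bigr => i _.
rewrite /= fgliftZ -[X in _ = << X *g _ >>]intz -freegU_mulz.
by congr (<< _ >> *~ _); apply/continuousEP.
Qed.

Definition singular_map : chain_map (singular R X) (singular R Y) :=
  @ChainMap (singular R X) (singular R Y) (fun n => @singular_fun n)
    singular_funE.

End SingularMap.
Arguments singular_map R {X Y} h.

Section SingularMapEq.
Variables (R : realType) (X Y Y' Z : topologicalType).
Variables (h : continuousType X Y) (k : continuousType Y Z).
Variables (h' : continuousType X Y') (k' : continuousType Y' Z).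
Hypothesis khE : forall x, k (h x) = k' (h' x).

Lemma singular_map_comm n c :
  singular_map R k n (singular_map R h n c) =
  singular_map R k' n (singular_map R h' n c).
Proof.
move: c; apply: (freeg_additive_eq
  (f := @singular_fun R _ _ k n \o @singular_fun R _ _ h n)
  (g := @singular_fun R _ _ k' n \o @singular_fun R _ _ h' n)) => s /=.
rewrite /singular_fun !fgliftU; congr (<< _ >>).
by case: n s => // n s; apply/continuousEP => x /=.
Qed.

End SingularMapEq.

Record morphism (X X' Y Y' : topologicalType)
    (f : continuousType X X') (g : continuousType Y Y') := Morphism {
  mor : continuousType X Y;
  mor' : continuousType X' Y';
  morE : forall x, g (mor x) = mor' (f x)
}.

Section MorphismHomology.
Variable R : realType.

Definition map_complex (X X' : topologicalType) (f : continuousType X X') :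
  chain_complex := cone (singular_map R f).

Variables (X X' Y Y' : topologicalType).
Variables (f : continuousType X X') (g : continuousType Y Y').

Definition map_complex_map (a : morphism f g) :
    chain_map (map_complex f) (map_complex g) :=
  @cone_map _ _ _ _ (singular_map R f) (singular_map R g)
    (singular_map R (mor a)) (singular_map R (mor' a))
    (singular_map_comm (morE a)).

Definition map_homology (n : int) : zmodType := homology (map_complex f) n.

End MorphismHomology.
Arguments map_complex R {X X'} f.
Arguments map_homology R {X X'} f n.

Definition map_homology_map (R : realType) (X X' Y Y' : topologicalType)
    (f : continuousType X X') (g : continuousType Y Y') (a : morphism f g)
    (n : int) : {additive map_homology R f n -> map_homology R g n} :=
  homology_map (map_complex_map R a) n.
Arguments map_homology_map R {X X' Y Y' f g} a n.

Definition closed_embedding (X Y : topologicalType) (e : continuousType X Y) :=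
  [/\ injective e, closed (range e) &
      forall A : set X, open A -> exists2 B : set Y, open B & A = e @^-1` B].

(* Neighbourhood retract of every metric space in which [X] embeds as a closed
   subspace; [r] is defined on the subspace [U] only, so that the empty space
   is an ANR. *)
Definition ANR (R : realType) (X : metricType R) : Prop :=
  forall (Y : metricType R) (e : continuousType X Y), closed_embedding e ->
  exists (U : set Y) (r : continuousType U X),
    [/\ open U, range e `<=` U & forall (u : U) x, val u = e x -> r u = x].

Record ANR_sequence (R : realType) := ANRSequence {
  src : nat -> metricType R;
  tgt : nat -> metricType R;
  anr_map :> forall i, continuousType (src i) (tgt i);
  src_compact : forall i, compact [set: src i];
  tgt_compact : forall i, compact [set: tgt i];
  src_ANR : forall i, ANR (src i);
  tgt_ANR : forall i, ANR (tgt i);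
  bond : forall i, morphism (anr_map i.+1) (anr_map i)
}.

Record level_morphism (R : realType) (F G : ANR_sequence R) := LevelMorphism {
  level :> forall i, morphism (F i) (G i);
  levelE : forall i x,
    mor (level i) (mor (bond F i) x) = mor (bond G i) (mor (level i.+1) x);
  levelE' : forall i x,
    mor' (level i) (mor' (bond F i) x) = mor' (bond G i) (mor' (level i.+1) x)
}.

Definition is_cone (X : nat -> topologicalType)
    (p : forall i, continuousType (X i.+1) (X i))
    (L : topologicalType) (pi : forall i, continuousType L (X i)) :=
  forall i x, p i (pi i.+1 x) = pi i x.

Definition is_inverse_limit (X : nat -> topologicalType)
    (p : forall i, continuousType (X i.+1) (X i))
    (L : topologicalType) (pi : forall i, continuousType L (X i)) :=
  is_cone p pi /\
  forall (Z : topologicalType) (h : forall i, continuousType Z (X i)),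
    is_cone p h ->
    exists! u : continuousType Z L, forall i z, pi i (u z) = h i z.

(* An inverse ANR-sequence together with projections exhibiting [f] as its
   inverse limit in topological spaces. *)
Record ANR_expansion (R : realType) (X X' : topologicalType)
    (f : continuousType X X') := ANRExpansion {
  expansion_seq :> ANR_sequence R;
  limit_proj : forall i, morphism f (expansion_seq i);
  src_limit : is_inverse_limit (X := fun i => src expansion_seq i)
    (fun i => mor (bond expansion_seq i)) (fun i => mor (limit_proj i));
  tgt_limit : is_inverse_limit (X := fun i => tgt expansion_seq i)
    (fun i => mor' (bond expansion_seq i)) (fun i => mor' (limit_proj i))
}.
Arguments ANR_expansion R {X X'} f.

Record limit_morphism (R : realType) (X X' Y Y' : topologicalType)
    (f : continuousType X X') (g : continuousType Y Y')
    (F : ANR_expansion R f) (G : ANR_expansion R g) (phi : morphism f g) :=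
  LimitMorphism {
  limit_level :> level_morphism F G;
  limit_levelE : forall i x,
    mor (limit_proj G i) (mor phi x) =
    mor (limit_level i) (mor (limit_proj F i) x);
  limit_levelE' : forall i x,
    mor' (limit_proj G i) (mor' phi x) =
    mor' (limit_level i) (mor' (limit_proj F i) x)
}.

Section ANRSequenceHomology.
Variables (R : realType) (F : ANR_sequence R).

(* The cone of (p_#, p'_#) : K_*(F) -> K_*(F), where K_*(F) is the product of
   the complexes of the maps [F i]. *)
Definition sequence_complex : chain_complex :=
  cone (shift_map (fun i => map_complex_map R (bond F i))).

Definition bond_homology (n : int) i :
    {additive map_homology R (F i.+1) n -> map_homology R (F i) n} :=
  map_homology_map R (bond F i) n.

Definition lim_homology (n : int) : zmodType := lim0 (bond_homology n).
Definition lim1_homology (n : int) : zmodType := lim1 (bond_homology n).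

End ANRSequenceHomology.

(* Strong homology of [f], computed from the expansion [F]. *)
Definition strong_homology (R : realType) (X X' : topologicalType)
    (f : continuousType X X') (F : ANR_expansion R f) (n : int) : zmodType :=
  homology (sequence_complex F) (n + 1).

Section InducedMaps.
Variables (R : realType) (F G : ANR_sequence R) (Phi : level_morphism F G).

Definition level_homology (n : int) i :
    {additive map_homology R (F i) n -> map_homology R (G i) n} :=
  map_homology_map R (Phi i) n.

Lemma level_complexE i n (c : map_complex R (F i.+1) n) :
  map_complex_map R (bond G i) n (map_complex_map R (Phi i.+1) n c) =
  map_complex_map R (Phi i) n (map_complex_map R (bond F i) n c).
Proof.
congr pair; apply: singular_map_comm => x; first by rewrite levelE.
by rewrite levelE'.
Qed.

Lemma level_homologyE n i x :
  bond_homology G n i (level_homology n i.+1 x) =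
  level_homology n i (bond_homology F n i x).
Proof.
by apply: homology_map_comm => c; apply: level_complexE.
Qed.

Definition lim_homology_map (n : int) :
    {additive lim_homology F n -> lim_homology G n} :=
  lim0_map (@level_homologyE n).

Definition lim1_homology_map (n : int) :
    {additive lim1_homology F n -> lim1_homology G n} :=
  lim1_map (@level_homologyE n).

Lemma sequence_complexE n c :
  shift_map (fun i => map_complex_map R (bond G i)) n
    (product_complex_map (fun i => map_complex_map R (Phi i)) n c) =
  product_complex_map (fun i => map_complex_map R (Phi i)) n
    (shift_map (fun i => map_complex_map R (bond F i)) n c).
Proof.
apply: (shift_diff_natural (a := fun i => map_complex_map R (bond F i) n)
  (b := fun i => map_complex_map R (bond G i) n)
  (f := fun i => map_complex_map R (Phi i) n)) => i x.
exact: level_complexE.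
Qed.

Definition sequence_complex_map :
    chain_map (sequence_complex F) (sequence_complex G) :=
  cone_map sequence_complexE.

End InducedMaps.

Definition strong_homology_map (R : realType) (X X' Y Y' : topologicalType)
    (f : continuousType X X') (g : continuousType Y Y')
    (F : ANR_expansion R f) (G : ANR_expansion R g) (phi : morphism f g)
    (Phi : limit_morphism F G phi) (n : int) :
    {additive strong_homology F n -> strong_homology G n} :=
  homology_map (sequence_complex_map Phi) (n + 1).

Definition short_exact (A B C : zmodType) (i : {additive A -> B})
    (p : {additive B -> C}) : Prop :=
  [/\ injective i, forall y, p y = 0 <-> exists x, i x = y
    & forall z, exists y, p y = z].

(* Main.v *)
(* For a tower p of chain complexes C_i, the cone Q of the shift map
   S = (p - 1) on the product of the C_i has cycles the pairs (x, y) with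
   dx = 0 and dy = Sx. Componentwise, the second condition says that the
   classes [x_i] are compatible under p, which gives the map
   H_m(Q) -> lim H_(m-1)(C_i); dually, z |-> (0, z) gives
   lim^1 H_m(C_i) -> H_m(Q). As cycles and boundaries of a product are taken
   componentwise, exactness is a direct computation with
   d(a, b) = (da, -db + Sa). Both maps are determined by their values on
   representing cycles, so naturality is checked there. *)
Require Import Defs.
From HB Require Import structures.
From mathcomp Require Import all_boot all_order all_algebra.
From mathcomp Require Import all_classical reals topology normedtype.

Import GRing.Theory.

Local Open Scope quotient_scope.
Local Open Scope ring_scope.

(** * Additive maps out of quotients, and choice in families *)

(** Any section of [s] followed by [t] works: [t] depends only on the value of [s], which also makes
    the composite additive. As [s] is onto, the equation determines [i]. This is how maps on
    homology and on lim^1 get defined on representing cycles. *)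
Lemma additive_factor (A B D : zmodType)
    (s : {additive A -> B}) (t : {additive A -> D}) :
  (forall b, exists a, s a = b) -> (forall a, s a = 0 -> t a = 0) ->
  exists i : {additive B -> D}, forall a, i (s a) = t a.
Proof.
move=> /choice[r rK] s0t0.
have st a a' : s a = s a' -> t a = t a'.
  move=> saa'; apply/eqP; rewrite -subr_eq0 -raddfB; apply/eqP/s0t0.
  by rewrite raddfB saa' subrr.
have tr_additive : zmod_morphism (t \o r).
  by move=> x y; rewrite /= -raddfB; apply: st; rewrite raddfB !rK.
pose i : {additive B -> D} :=
  HB.pack (t \o r) (GRing.isZmodMorphism.Build _ _ (t \o r) tr_additive).
by exists i => a; apply: st; apply: rK.
Qed.

Lemma product_choice (I : Type) (T : I -> Type) (P : forall i, T i -> Prop) :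
  (forall i, exists y, P i y) -> exists f, forall i, P i (f i).
Proof. by move=> Pex; exists (fun i => sval (cid (Pex i))) => i; case: cid. Qed.

Section QuotientClass.
Variables (V : zmodType) (I : zmodClosed V).

Lemma quotient_class_eq0 x : \pi_{ideal_quot I} x = 0 <-> x \in I.
Proof.
rewrite -[x in x \in I]subr0 Quotient.idealrBE raddf0.
by split=> [->|/eqP].
Qed.

Lemma quotient_class_surj (q : {ideal_quot I}) :
  exists x, \pi_{ideal_quot I} x = q.
Proof. by exists (repr q); rewrite reprK. Qed.

End QuotientClass.

(** * Cycles and boundaries, in a complex and in a cone *)

Definition homology_class (C : chain_complex) (n : int) :
    {additive cycles C n -> homology C n} :=
  \pi_{ideal_quot (@boundaries C n)}.

Lemma homology_class_surj (C : chain_complex) n (u : homology C n) :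
  exists z, homology_class C n z = u.
Proof. exact: quotient_class_surj. Qed.

(* Stated in degree [j - 1] so that boundaries come from degree [j] without the
   cast in [boundaries]. *)
Lemma homology_class_eq0 (C : chain_complex) (j : int)
    (z : cycles C (j - 1)) :
  homology_class C (j - 1) z = 0 <-> exists c, diff C j c = val z.
Proof.
(* [k] stands for [j - 1 + 1]. Once it is replaced by [j], the cast runs along a proof of
   [j - 1 = j - 1], which is trivial because [int] has decidable equality. *)
suff bndP k (e : k - 1 = j - 1) : k = j ->
    (exists c, ecast m (C m) e (diff C k c) = val z) <->
    (exists c, diff C j c = val z).
  apply: (iff_trans (quotient_class_eq0 _ _ z)).
  apply: iff_trans (bndP _ (addrK 1 (j - 1)) (subrK 1 j)).
  by split=> /asboolP.
by move=> kj; subst k; rewrite (eq_axiomK e).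
Qed.

Lemma cycles_lift (C : chain_complex) n (c : C n) :
  diff C n c = 0 -> exists z : cycles C n, val z = c.
Proof.
move=> dc; have cK : c \in in_kernel (diff C n) by rewrite unfold_in dc.
by exists (Kernel cK).
Qed.

Lemma cone_diffP (L M : chain_complex) (h : chain_map L M) n
    (c : cone h n) (d : cone h (n - 1)) :
  diff (cone h) n c = d <->
  diff L (n - 1) c.1 = d.1 /\ diff M n c.2 = h (n - 1) c.1 - d.2.
Proof.
split=> [<-|[dc1 dc2]]; first by rewrite /= opprD opprK addrCA subrr addr0.
by rewrite [d]surjective_pairing; congr pair; rewrite //= dc2 opprB subrK.
Qed.

Lemma cone_cycleP (L M : chain_complex) (h : chain_map L M) n (c : cone h n) :
  diff (cone h) n c = 0 <->
  diff L (n - 1) c.1 = 0 /\ diff M n c.2 = h (n - 1) c.1.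
Proof. by rewrite -[h _ _]subr0; apply: cone_diffP. Qed.

(** * Families of cycles representing elements of products and of lim^1 *)

Section Tower.
Variables (C : nat -> chain_complex) (p : forall i, chain_map (C i.+1) (C i)).

Lemma product_cycles_lift n (x : product_complex C n) :
  diff (product_complex C) n x = 0 ->
  exists z : product (fun i => cycles (C i) n), forall i, val (z i) = x i.
Proof.
move=> dx; apply: (product_choice _ _ (fun i y => val y = x i)) => i.
apply: cycles_lift.
exact: (congr1 (fun y => y i) dx).
Qed.

Definition homology_classes n :
    {additive product (fun i => cycles (C i) n) ->
              product (fun i => homology (C i) n)} :=
  product_map (fun i => homology_class (C i) n).

Lemma homology_classes_surj n u : exists z, homology_classes n z = u.
Proof.
have [z zu] := product_choice _ _ _
  (fun i => homology_class_surj (C i) n (u i)).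
by exists z; apply: functional_extensionality_dep.
Qed.

Lemma homology_classes_eq0 j z :
  homology_classes (j - 1) z = 0 <->
  exists c : product_complex C j, forall i, diff (C i) j (c i) = val (z i).
Proof.
split=> [z0|[c cz]].
  apply: (product_choice _ _ (fun i c => diff (C i) j c = val (z i))) => i.
  apply/homology_class_eq0.
  exact: (congr1 (fun u => u i) z0).
apply: functional_extensionality_dep => i; apply/homology_class_eq0.
by exists (c i).
Qed.

Let h n i := homology_map (p i) n.

Definition cycles_shift n :
    {additive product (fun i => cycles (C i) n) ->
              product (fun i => cycles (C i) n)} :=
  shift_diff (fun i => cycles_map (p i) n).

Lemma shift_homology_classes n z :
  shift_diff (h n) (homology_classes n z) =
  homology_classes n (cycles_shift n z).
Proof.
apply: (shift_diff_natural (a := fun i => cycles_map (p i) n)) => i x.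
exact: homology_mapE.
Qed.

Definition lim1_class n :
    {additive product (fun i => cycles (C i) n) -> lim1 (h n)} :=
  \pi_{ideal_quot (in_image (shift_diff (h n)))} \o homology_classes n.

Lemma lim1_class_surj n u : exists z, lim1_class n z = u.
Proof.
have [v <-] := quotient_class_surj _ _ u.
by have [z <-] := homology_classes_surj n v; exists z.
Qed.

(** A family of homology classes whose shift is the class of [z] lifts to a family of cycles [a],
    and the shift commutes with taking classes. This turns a condition on homology into one on
    chains. *)
Lemma lim1_class_eq0 n z :
  lim1_class n z = 0 <->
  exists a, homology_classes n (z - cycles_shift n a) = 0.
Proof.
apply: (iff_trans (quotient_class_eq0 _ _ _)).
split=> [/asboolP[u]|[a]].
  have [a <-] := homology_classes_surj n u.
  move=> /(etrans (esym (shift_homology_classes n a))) az.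
  by exists a; rewrite raddfB az subrr.
rewrite raddfB => /eqP; rewrite subr_eq0 => /eqP za; apply/asboolP.
exists (homology_classes n a).
by apply: etrans (shift_homology_classes n a) _; rewrite za.
Qed.

(** * Maps between cycles of the cone and cycles of the tower *)

Let Q := cone (shift_map p).

Lemma cone_incl_in_kernel n (z : product (fun i => cycles (C i) n)) :
  ((0, fun i => val (z i)) : Q n) \in in_kernel (diff Q n).
Proof.
rewrite unfold_in; apply/eqP/cone_cycleP; split; rewrite raddf0 //.
by apply: functional_extensionality_dep => i; apply: kernelP.
Qed.

Definition cone_incl n (z : product (fun i => cycles (C i) n)) :
  cycles Q n := Kernel (cone_incl_in_kernel n z).

Lemma cone_incl_is_additive n : zmod_morphism (cone_incl n).
Proof.
by move=> x y; apply: val_inj; rewrite raddfB /=; congr pair; rewrite subrr.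
Qed.

HB.instance Definition _ n := GRing.isZmodMorphism.Build _ _ (cone_incl n)
  (cone_incl_is_additive n).

Lemma cone_proj_in_kernel n (z : cycles Q n) i :
  (val z).1 i \in in_kernel (diff (C i) (n - 1)).
Proof.
have /cone_cycleP[dz _] := kernelP z.
by rewrite unfold_in; apply/eqP; apply: (congr1 (fun x => x i) dz).
Qed.

Definition cone_proj n (z : cycles Q n) :
    product (fun i => cycles (C i) (n - 1)) :=
  fun i => Kernel (cone_proj_in_kernel n z i).

Lemma cone_proj_is_additive n : zmod_morphism (cone_proj n).
Proof.
by move=> x y; apply: functional_extensionality_dep => i; apply: val_inj.
Qed.

HB.instance Definition _ n := GRing.isZmodMorphism.Build _ _ (cone_proj n)
  (cone_proj_is_additive n).

Lemma lim0_class_in_kernel n (z : cycles Q n) :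
  homology_classes (n - 1) (cone_proj n z) \in
    in_kernel (shift_diff (h (n - 1))).
Proof.
rewrite unfold_in; apply/eqP; apply: etrans (shift_homology_classes _ _) _.
apply/homology_classes_eq0; exists (val z).2 => i.
have /cone_cycleP[_ dz] := kernelP z.
exact: (congr1 (fun y => y i) dz).
Qed.

Definition lim0_class n (z : cycles Q n) : lim0 (h (n - 1)) :=
  Kernel (lim0_class_in_kernel n z).

Lemma lim0_class_is_additive n : zmod_morphism (lim0_class n).
Proof.
move=> x y; apply: val_inj.
by rewrite [LHS](raddfB (homology_classes (n - 1) \o cone_proj n)).
Qed.

HB.instance Definition _ n := GRing.isZmodMorphism.Build _ _ (lim0_class n)
  (lim0_class_is_additive n).

(** * Exactness of the sequence of a tower *)

(** The equation d(a, b) = (0, z) says da = 0 and db = Sa - z: [a] is a family of cycles and -b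
    bounds z - Sa. One direction makes the map on lim^1 well defined, the other makes it
    injective. *)
Lemma cone_incl_class_eq0 j z :
  homology_class Q (j - 1) (cone_incl (j - 1) z) = 0 <->
  lim1_class (j - 1) z = 0.
Proof.
apply: iff_sym.
apply: (iff_trans (lim1_class_eq0 _ _)).
split=> [[a /homology_classes_eq0[b bz]]|/homology_class_eq0[[a b] abz]].
  apply/homology_class_eq0; exists ((fun i => val (a i)), - b : product _).
  apply/cone_diffP; split; apply: functional_extensionality_dep => i.
    exact: kernelP.
  apply: etrans (raddfN (diff (C i) j) (b i)) _; rewrite bz.
  exact: opprB.
have /cone_diffP[da db] := abz.
have [a' aa'] := product_cycles_lift _ _ da.
exists a'; apply/homology_classes_eq0; exists (- b : product _) => i.
apply: etrans (raddfN (diff (C i) j) (b i)) _.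
rewrite [diff _ _ _](congr1 (fun y => y i) db).
apply: etrans (opprB _ _) _; congr (_ - _).
by rewrite -[a]/((a, b).1) -(functional_extensionality_dep aa').
Qed.

(** Compatibility of the classes of [x] means that Sx bounds componentwise; a bounding family [y]
    completes [x] to a cycle (x, y) of the cone. *)
Lemma lim0_class_surj j u : exists z, lim0_class (j - 1) z = u.
Proof.
have [x xu] := homology_classes_surj (j - 1 - 1) (val u).
have := kernelP u; rewrite -xu.
move=> /(etrans (esym (shift_homology_classes _ _)))/homology_classes_eq0[y yx].
have xyK : diff Q (j - 1) ((fun i => val (x i)), y) = 0.
  apply/cone_cycleP; split; apply: functional_extensionality_dep => i.
    exact: kernelP.
  exact: yx.
have [z zxy] := cycles_lift _ _ _ xyK.
exists z; apply: val_inj; rewrite /= -xu; congr (homology_classes _ _).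
apply: functional_extensionality_dep => i; apply: val_inj => /=.
by rewrite zxy.
Qed.

(** Write z = (x', y). If x' = da, subtracting d(a, 0) = (da, Sa) leaves (0, y - Sa), which comes
    from lim^1. Conversely, a boundary d(a, b) equal to z - (0, x) has first component da = x'. *)
Lemma lim0_class_eq0 j z :
  lim0_class (j - 1) z = 0 <->
  exists x, homology_class Q (j - 1) (cone_incl (j - 1) x) =
            homology_class Q (j - 1) z.
Proof.
have /cone_cycleP[dz1 dz2] := kernelP z.
split=> [/(congr1 val)/homology_classes_eq0[a az]|[x /eqP]]; last first.
  rewrite eq_sym -subr_eq0 -raddfB => /eqP/homology_class_eq0[[a b]].
  move=> /cone_diffP[da _].
  apply: val_inj; apply/homology_classes_eq0; exists a => i.
  rewrite [LHS](congr1 (fun y => y i) da); exact: subr0.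
(* d(y - Sa) = 0, since dy = Sx' = S(da) = d(Sa). *)
have yK : diff (product_complex C) (j - 1)
    ((val z).2 - shift_map p (j - 1) a) = 0.
  rewrite raddfB dz2 -chain_funE; apply/eqP; rewrite subr_eq0; apply/eqP.
  by congr (shift_map _ _ _); apply: functional_extensionality_dep => i;
    apply: esym (az i).
have [x xE] := product_cycles_lift _ _ yK.
exists x; apply/eqP; rewrite eq_sym -subr_eq0 -raddfB; apply/eqP.
apply/homology_class_eq0; exists (a, 0); apply/cone_diffP; split.
  apply: functional_extensionality_dep => i.
  exact: etrans (az i) (esym (subr0 _)).
rewrite raddf0; apply: functional_extensionality_dep => i.
apply: esym; apply: etrans (_ : _ - ((val z).2 i - val (x i)) = 0); first by [].
by rewrite xE; apply/eqP; rewrite subr_eq0; apply/eqP/esym/subKr.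
Qed.

(** The two formulas on representing cycles are kept beside exactness because they determine [i] and
    [q], and naturality is checked through them. *)
Lemma milnor_sequence j :
  exists (i : {additive lim1 (h (j - 1)) -> homology Q (j - 1)})
         (q : {additive homology Q (j - 1) -> lim0 (h (j - 1 - 1))}),
    [/\ short_exact i q,
        forall z, i (lim1_class (j - 1) z) =
                  homology_class Q (j - 1) (cone_incl (j - 1) z)
      & forall z, q (homology_class Q (j - 1) z) = lim0_class (j - 1) z].
Proof.
have [i iE] := additive_factor _ _ _ (lim1_class (j - 1))
  (homology_class Q (j - 1) \o cone_incl (j - 1)) (lim1_class_surj _)
  (fun z => iffRL (cone_incl_class_eq0 j z)).
have [|q qE] := additive_factor _ _ _ (homology_class Q (j - 1))
  (lim0_class (j - 1)) (homology_class_surj _ _).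
  (* A null-homologous [z] is homologous to the image of [0], so its limit class vanishes. *)
  by move=> z z0; apply/lim0_class_eq0; exists 0; rewrite z0 !raddf0.
exists i, q; split=> //; split=> [|y|u].
- apply: raddf_inj => u; have [z <-] := lim1_class_surj _ u.
  by rewrite iE => /cone_incl_class_eq0.
- have [z <-] := homology_class_surj _ _ y; rewrite qE lim0_class_eq0.
  split=> [[x <-]|[u]]; first by exists (lim1_class (j - 1) x).
  have [x <-] := lim1_class_surj _ u.
  by rewrite iE => xz; exists x.
- have [z <-] := lim0_class_surj _ u.
  by exists (homology_class Q (j - 1) z).
Qed.

End Tower.

(** * Naturality for level morphisms *)

Theorem theorem2p5 (R : realType) (X X' Y Y' : topologicalType)
    (f : continuousType X X') (g : continuousType Y Y')
    (F : ANR_expansion R f) (G : ANR_expansion R g)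
    (phi : morphism f g) (Phi : limit_morphism F G phi) (n : int) :
  exists (iF : {additive lim1_homology F (n + 1) -> strong_homology F n})
         (pF : {additive strong_homology F n -> lim_homology F n})
         (iG : {additive lim1_homology G (n + 1) -> strong_homology G n})
         (pG : {additive strong_homology G n -> lim_homology G n}),
    [/\ short_exact iF pF,
        short_exact iG pG,
        forall u, iG (lim1_homology_map Phi (n + 1) u) =
                  strong_homology_map Phi n (iF u)
      & forall v, pG (strong_homology_map Phi n v) =
                  lim_homology_map Phi n (pF v)].
Proof.
(* The degrees become variables because n + 2 - 1 and n + 1 - 1 equal n + 1 and n only
   propositionally; substitution then gives the degrees of [milnor_sequence] without casts. *)
suff rows j m k : j - 1 = m -> m - 1 = k ->
  exists (iF : {additive lim1_homology F m -> homology (sequence_complex F) m})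
         (pF : {additive homology (sequence_complex F) m -> lim_homology F k})
         (iG : {additive lim1_homology G m -> homology (sequence_complex G) m})
         (pG : {additive homology (sequence_complex G) m -> lim_homology G k}),
    [/\ short_exact iF pF,
        short_exact iG pG,
        forall u, iG (lim1_homology_map Phi m u) =
                  homology_map (sequence_complex_map Phi) m (iF u)
      & forall v, pG (homology_map (sequence_complex_map Phi) m v) =
                  lim_homology_map Phi k (pF v)].
  exact: (rows (n + 1 + 1) (n + 1) n (addrK 1 (n + 1)) (addrK 1 n)).
move=> <- <-.
have [iF [pF [exF iFE pFE]]] :=
  milnor_sequence _ (fun i => map_complex_map R (bond F i)) j.
have [iG [pG [exG iGE pGE]]] :=
  milnor_sequence _ (fun i => map_complex_map R (bond G i)) j.
pose PhiZ l := product_map (fun i => cycles_map (map_complex_map R (Phi i)) l).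
have classE l z : homology_classes _ l (PhiZ l z) =
    product_map (level_homology Phi l) (homology_classes _ l z).
  apply: functional_extensionality_dep => i.
  by apply: esym; apply: homology_mapE.
exists iF, pF, iG, pG; split=> // [u|v].
  have [z <-] := lim1_class_surj _ _ _ u; rewrite iFE.
  (* On lim^1 the level morphism acts on representatives by [PhiZ]. *)
  have -> : lim1_homology_map Phi (j - 1) (lim1_class _ _ (j - 1) z) =
            lim1_class _ _ (j - 1) (PhiZ _ z).
    apply: etrans (quotient_funE (cokernel_map_subproof (shift_diff_natural
      (@level_homologyE _ _ _ Phi (j - 1)))) _) _.
    by congr (\pi_ _ _); rewrite [RHS]classE.
  rewrite iGE [RHS]homology_mapE; congr (homology_class _ _ _).
  (* The second components agree by computation; the first ones are 0 and the image of 0 under the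
     level maps. *)
  apply: val_inj; congr pair.
  by apply: functional_extensionality_dep => i; apply: esym; apply: raddf0.
have [z <-] := homology_class_surj _ _ v; rewrite pFE.
rewrite [homology_map _ _ _]homology_mapE pGE.
apply: val_inj; apply: etrans (classE _ _).
congr (homology_classes _ _ _).
by apply: functional_extensionality_dep => i; apply: val_inj.
Qed.
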